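(* Let $(\mathcal{M},g,\overset{1}{\nabla})$ be an $n$-dimensional ($n\ge 3$) GRW space-time with a semi-symmetric metric $P$-connection, $P$ unit timelike. Then the Ricci tensors $\overset{0}{Ric}$, $\overset{4}{Ric}$ and $\overset{5}{Ric}$ are non-zero.
   Context: Setting: $(\mathcal{M},g)$ is a Lorentzian manifold of signature $(-,+,\dots,+)$ with Levi-Civita connection $\overset{g}{\nabla}$; $P$ is a vector field with $g(P,P)=-1$, and $\pi(\cdot)=g(\cdot,P)$. The connection $\overset{1}{\nabla}_XY=\overset{g}{\nabla}_XY+\pi(Y)X-g(X,Y)P$ is a semi-symmetric metric $P$-connection, i.e. $\overset{1}{\nabla}P=0$; equivalently $\overset{g}{\nabla}_XP=X+\pi(X)P$ for all $X$. Such a manifold is a generalized Robertson-Walker (GRW) space-time (locally a warped product with metric $-(\mathrm dt)^2+f(t)^2g^*$, $g^*$ Riemannian). Associated connections: the mutual connection $\overset{2}{\nabla}_XY=\overset{1}{\nabla}_YX+[X,Y]$, that is $\overset{2}{\nabla}_XY=\overset{g}{\nabla}_XY+\pi(X)Y-g(X,Y)P$, and the symmetric connection $\overset{0}{\nabla}_XY=\frac12(\overset{1}{\nabla}_XY+\overset{2}{\nabla}_XY)$. Curvature tensors used: $\overset{0}{R}(X,Y)Z=\overset{0}{\nabla}_X\overset{0}{\nabla}_YZ-\overset{0}{\nabla}_Y\overset{0}{\nabla}_XZ-\overset{0}{\nabla}_{[X,Y]}Z$; $\overset{4}{R}(X,Y)Z=\overset{2}{\nabla}_X\overset{1}{\nabla}_YZ-\overset{1}{\nabla}_Y\overset{2}{\nabla}_XZ+\overset{2}{\nabla}_{\overset{2}{\nabla}_YX}Z-\overset{1}{\nabla}_{\overset{1}{\nabla}_XY}Z$;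 $\overset{5}{R}(X,Y)Z=\frac12\big(\overset{1}{\nabla}_X\overset{1}{\nabla}_YZ-\overset{2}{\nabla}_Y\overset{1}{\nabla}_XZ+\overset{2}{\nabla}_X\overset{2}{\nabla}_YZ-\overset{1}{\nabla}_Y\overset{2}{\nabla}_XZ-\overset{1}{\nabla}_{[X,Y]}Z-\overset{2}{\nabla}_{[X,Y]}Z\big)$. The Ricci tensors are the contractions with respect to $X$: $\overset{\theta}{Ric}(Y,Z)=\mathrm{tr}\big(X\mapsto\overset{\theta}{R}(X,Y)Z\big)$. *)

(* Defs.v *)
From HB Require Import structures.
From mathcomp Require Import all_boot all_order all_algebra.
From mathcomp Require Import all_classical all_reals all_analysis.

Set Implicit Arguments.
Unset Strict Implicit.
Unset Printing Implicit Defensive.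

Import Order.TTheory GRing.Theory Num.Theory.
Import numFieldNormedType.Exports.

Local Open Scope classical_set_scope.
Local Open Scope ring_scope.

(** C^k maps on an open subset [U] of a normed space.

   [f] is total; its values outside [U] are irrelevant since [U] is open. *)

Fixpoint Ck (R : realType) (V W : normedModType R) (k : nat) (U : set V)
    (f : V -> W) : Prop :=
  if k is k'.+1 then
    (forall x, U x -> differentiable f x) /\ (forall v, Ck k' U ('D_v f))
  else forall x, U x -> {for x, continuous f}.

Definition smooth (R : realType) (V W : normedModType R) (U : set V)
    (f : V -> W) : Prop :=
  forall k, Ck k U f.

Record chart (R : realType) (n : nat) (M : topologicalType) := Chart {
  dom : set M;
  coord : M -> 'rV[R]_n;
  unchart : 'rV[R]_n -> M;
  dom_open : open dom;
  codom_open : open (coord @` dom);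
  chartK : forall p, dom p -> unchart (coord p) = p;
  coord_continuous : {within dom, continuous coord};
  unchart_continuous : {within coord @` dom, continuous unchart}
}.

Definition transition_smooth (R : realType) (n : nat) (M : topologicalType)
    (c d : chart R n M) : Prop :=
  smooth (coord c @` (dom c `&` dom d)) (coord d \o unchart c).

(** [chart_at p] is a chosen chart of the atlas around [p]. *)
Record manifold (R : realType) (n : nat) := Manifold {
  carrier :> topologicalType;
  carrier_nonempty : [set: carrier] !=set0;
  carrier_hausdorff : hausdorff_space carrier;
  carrier_second_countable : @second_countable carrier;
  atlas : set (chart R n carrier);
  atlas_compat : forall c d, atlas c -> atlas d -> transition_smooth c d;
  chart_at : carrier -> chart R n carrier;
  chart_at_atlas : forall p, atlas (chart_at p);
  chart_at_dom : forall p, dom (chart_at p) p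
}.

Definition smooth_on (R : realType) (n : nat) (M : manifold R n)
    (V : normedModType R) (W : set M) (f : M -> V) : Prop :=
  forall c, atlas c -> smooth (coord c @` (W `&` dom c)) (f \o unchart c).

(** Vector fields.

   T_p M is identified with R^n through the coordinate basis of [chart_at p]
   at [p]; hence [X p : 'rV_n] is a tangent vector at [p].  Fields are total
   functions, and are only used on open sets where they are smooth. *)

Definition vfield (R : realType) (n : nat) (M : manifold R n) : Type :=
  M -> 'rV[R]_n.

(** The derivative X(f) of a (scalar or vector valued) function f. *)
Definition vderiv (R : realType) (n : nat) (M : manifold R n)
    (V : normedModType R) (X : vfield M) (f : M -> V) : M -> V :=
  fun p => 'D_(X p) (f \o unchart (chart_at p)) (coord (chart_at p) p).

(** The components (X(x^1), ..., X(x^n)) of X in the chart c = (x^1, ..., x^n),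
   meaningful on [dom c]. *)
Definition components (R : realType) (n : nat) (M : manifold R n)
    (c : chart R n M) (X : vfield M) : M -> 'rV[R]_n :=
  vderiv X (coord c).

Definition smooth_vfield (R : realType) (n : nat) (M : manifold R n)
    (W : set M) (X : vfield M) : Prop :=
  forall c, atlas c ->
    smooth (coord c @` (W `&` dom c)) (components c X \o unchart c).

(** The field v^i d/dx^i on [dom c], with constant components v in the chart c. *)
Definition coord_vfield (R : realType) (n : nat) (M : manifold R n)
    (c : chart R n M) (v : 'rV[R]_n) : vfield M :=
  fun q => 'D_v (coord (chart_at q) \o unchart c) (coord c q).

(** [X, Y]^i = X(Y^i) - Y(X^i), computed at p in the chart [chart_at p]. *)
Definition bracket (R : realType) (n : nat) (M : manifold R n)
    (X Y : vfield M) : vfield M :=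
  fun p => vderiv X (components (chart_at p) Y) p
         - vderiv Y (components (chart_at p) X) p.

(** [g p] is the Gram matrix of the metric on T_p M. *)
Definition inner (R : realType) (n : nat) (M : manifold R n)
    (g : M -> 'M[R]_n) (X Y : vfield M) : M -> R :=
  fun p => (X p *m g p *m (Y p)^T) 0 0.

Record is_lorentzian (R : realType) (n : nat) (M : manifold R n.+1)
    (g : M -> 'M[R]_n.+1) : Prop := IsLorentzian {
  metric_sym : forall p, (g p)^T = g p;
  metric_signature : forall p, exists2 B : 'M[R]_n.+1, B \in unitmx &
    B *m g p *m B^T = block_mx (-1 : 'M[R]_1) 0 0 (1%:M : 'M[R]_n);
  metric_smooth : forall (W : set M) (X Y : vfield M), open W ->
    smooth_vfield W X -> smooth_vfield W Y ->
    smooth_on (V := R^o) W (inner g X Y)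
}.

(** Gram matrix of the metric in the coordinate frame of the chart c. *)
Definition gram (R : realType) (n : nat) (M : manifold R n)
    (g : M -> 'M[R]_n) (c : chart R n M) (q : M) : 'M[R]_n :=
  \matrix_(i, j) inner g (coord_vfield c (delta_mx 0 i))
                         (coord_vfield c (delta_mx 0 j)) q.

(** Around every point there are coordinates (t, x) in which
   g = - dt^2 + f(t)^2 h(x), with h Riemannian. *)
Definition is_GRW (R : realType) (n : nat) (M : manifold R n.+1)
    (g : M -> 'M[R]_n.+1) : Prop :=
  forall p : M, exists c : chart R n.+1 M,
  [/\ dom c p,
      forall d, atlas d -> transition_smooth c d /\ transition_smooth d c &
      let t q : R^o := lsubmx (coord c q : 'rV[R]_(1 + n)) 0 0 in
      let x q : 'rV[R]_n := rsubmx (coord c q : 'rV[R]_(1 + n)) in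
      exists (f : R^o -> R^o) (h : 'rV[R]_n -> 'M[R]_n),
      [/\ smooth (t @` dom c) f /\ (forall q, dom c q -> 0 < f (t q)),
          smooth (x @` dom c) h,
          forall q, dom c q -> (h (x q))^T = h (x q) /\
            forall v : 'rV[R]_n, v != 0 -> 0 < (v *m h (x q) *m v^T) 0 0 &
          forall q, dom c q ->
            gram g c q = block_mx (-1 : 'M[R]_1) 0 0
                                  (f (t q) ^+ 2 *: h (x q))]].

(** Linear connections.

   A connection acts on the fields that are smooth on some open set; its axioms
   are required on every open set, which makes it a local operator. *)

Record is_connection (R : realType) (n : nat) (M : manifold R n)
    (D : vfield M -> vfield M -> vfield M) : Prop := IsConnection {
  connection_smooth : forall (W : set M) (X Y : vfield M), open W ->
    smooth_vfield W X -> smooth_vfield W Y -> smooth_vfield W (D X Y);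
  connection_addl : forall (W : set M) (X X' Y : vfield M), open W ->
    smooth_vfield W X -> smooth_vfield W X' -> smooth_vfield W Y ->
    forall p, W p -> D (X + X') Y p = D X Y p + D X' Y p;
  connection_scalel : forall (W : set M) (f : M -> R^o) (X Y : vfield M),
    open W -> smooth_on W f -> smooth_vfield W X -> smooth_vfield W Y ->
    forall p, W p -> D (fun q => f q *: X q) Y p = f p *: D X Y p;
  connection_addr : forall (W : set M) (X Y Y' : vfield M), open W ->
    smooth_vfield W X -> smooth_vfield W Y -> smooth_vfield W Y' ->
    forall p, W p -> D X (Y + Y') p = D X Y p + D X Y' p;
  connection_leibniz : forall (W : set M) (f : M -> R^o) (X Y : vfield M),
    open W -> smooth_on W f -> smooth_vfield W X -> smooth_vfield W Y ->
    forall p, W p ->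
      D X (fun q => f q *: Y q) p = f p *: D X Y p + vderiv X f p *: Y p
}.

Record is_levi_civita (R : realType) (n : nat) (M : manifold R n)
    (g : M -> 'M[R]_n) (D : vfield M -> vfield M -> vfield M) : Prop :=
  IsLeviCivita {
  levi_civita_connection : is_connection D;
  levi_civita_torsion_free : forall (W : set M) (X Y : vfield M), open W ->
    smooth_vfield W X -> smooth_vfield W Y ->
    forall p, W p -> D X Y p - D Y X p = bracket X Y p;
  levi_civita_metric : forall (W : set M) (X Y Z : vfield M), open W ->
    smooth_vfield W X -> smooth_vfield W Y -> smooth_vfield W Z ->
    forall p, W p ->
      vderiv (V := R^o) X (inner g Y Z) p
      = inner g (D X Y) Z p + inner g Y (D X Z) p
}.

(** Semi-symmetric metric connection with generator P. *)
Definition nabla1 (R : realType) (n : nat) (M : manifold R n)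
    (g : M -> 'M[R]_n) (P : vfield M) (D : vfield M -> vfield M -> vfield M)
    (X Y : vfield M) : vfield M :=
  fun p => D X Y p + inner g Y P p *: X p - inner g X Y p *: P p.

Definition mutual (R : realType) (n : nat) (M : manifold R n)
    (D1 : vfield M -> vfield M -> vfield M) (X Y : vfield M) : vfield M :=
  D1 Y X + bracket X Y.

Definition symmetrized (R : realType) (n : nat) (M : manifold R n)
    (D1 : vfield M -> vfield M -> vfield M) (X Y : vfield M) : vfield M :=
  2^-1 *: (D1 X Y + mutual D1 X Y).

Definition is_parallel (R : realType) (n : nat) (M : manifold R n)
    (D : vfield M -> vfield M -> vfield M) (P : vfield M) : Prop :=
  forall (W : set M) (X : vfield M), open W -> smooth_vfield W X ->
    forall p, W p -> D X P p = 0.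

Definition curv0 (R : realType) (n : nat) (M : manifold R n)
    (D1 : vfield M -> vfield M -> vfield M) (X Y Z : vfield M) : vfield M :=
  let D0 := symmetrized D1 in
  D0 X (D0 Y Z) - D0 Y (D0 X Z) - D0 (bracket X Y) Z.

Definition curv4 (R : realType) (n : nat) (M : manifold R n)
    (D1 : vfield M -> vfield M -> vfield M) (X Y Z : vfield M) : vfield M :=
  let D2 := mutual D1 in
  D2 X (D1 Y Z) - D1 Y (D2 X Z) + D2 (D2 Y X) Z - D1 (D1 X Y) Z.

Definition curv5 (R : realType) (n : nat) (M : manifold R n)
    (D1 : vfield M -> vfield M -> vfield M) (X Y Z : vfield M) : vfield M :=
  let D2 := mutual D1 in
  2^-1 *: (D1 X (D1 Y Z) - D2 Y (D1 X Z) + D2 X (D2 Y Z) - D1 Y (D2 X Z)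
           - D1 (bracket X Y) Z - D2 (bracket X Y) Z).

(** Ric(Y, Z) = tr (X |-> R(X, Y) Z).  At p, a tangent vector v is extended to
   the field with constant components v in [chart_at p]. *)
Definition ricci (R : realType) (n : nat) (M : manifold R n)
    (Rm : vfield M -> vfield M -> vfield M -> vfield M) (Y Z : vfield M) :
    M -> R :=
  fun p => \tr (lin1_mx (fun v => Rm (coord_vfield (chart_at p) v) Y Z p)).

Definition is_zero_tensor (R : realType) (n : nat) (M : manifold R n)
    (T : vfield M -> vfield M -> M -> R) : Prop :=
  forall Y Z : vfield M, smooth_vfield setT Y -> smooth_vfield setT Z ->
    forall p, T Y Z p = 0.

(* Main.v *)
Require Import Defs.
From HB Require Import structures.
From mathcomp Require Import all_boot all_order all_algebra.
From mathcomp Require Import all_classical all_reals all_analysis.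
From mathcomp Require Import ring.

Set Implicit Arguments.
Unset Strict Implicit.
Unset Printing Implicit Defensive.

Import Order.TTheory GRing.Theory Num.Theory.
Import numFieldNormedType.Exports.

Local Open Scope classical_set_scope.
Local Open Scope ring_scope.

(** Each of the three tensors is already non-zero on the pair (P, P).

   The condition that P is parallel for the semi-symmetric connection says that
   nabla^g_X P = A(X), where A(X) = X + pi(X) P is the orthogonal projection of
   X onto the complement of P ([connection_P]); in particular nabla^g_P P = 0.
   Metric compatibility then makes nabla^g_P commute with A
   ([connection_P_spatial]), and torsion-freeness gives
   A([X, P]) = A(X) - A(nabla^g_P X).  In R(X, P)P every derivative of X is thus
   of the form A(nabla^g_P X), and these terms cancel:
<<
     R^0(X, P)P = - A(X)/4,    R^4(X, P)P = - A(X),    R^5(X, P)P = - A(X)/2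
>>
   ([curv0_PP], [curv4_PP], [curv5_PP]).  The trace of A in dimension n + 1 is n,
   so Ric(P, P) is a non-zero multiple of n.  As P is a global field, the tensor
   can be evaluated on it without cut-off functions.

   What remains is to justify this computation for total fields that are smooth
   only on an open set.  The trace is taken over coordinate fields, which are
   smooth on the domain of their chart alone ([smooth_coord_vfield], which
   requires that C^k maps be stable under composition), and an identity such as
   nabla^2_X P = A(X) holds only there.  One can nevertheless differentiate such
   an identity, because the axioms of a connection make it a local operator
   ([connection_local]). *)

(* The name [coord] also denotes coordinates with respect to a basis. *)
Local Notation coord := Defs.coord.

(** * Calculus of C^k maps *)

Section CkCalculus.
Context {R : realType}.
Implicit Types V W : normedModType R.

Lemma open_near_eq V W (U : set V) (f f' : V -> W) x :
  open U -> (forall y, U y -> f y = f' y) -> U x -> {near x, f =1 f'}.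
Proof.
by move=> oU ff' Ux; near=> y; apply: ff'; near: y; exact: open_nbhs_nbhs.
Unshelve. all: by end_near. Qed.

(** The differential is selected by a choice operator, so this does not follow by
   rewriting: the expansion of [f] is carried over to [f'], and uniqueness
   identifies the two differentials. *)
Lemma near_eq_differentiable V W (f f' : V -> W) x :
  {near x, f =1 f'} -> differentiable f x -> differentiable f' x.
Proof.
move=> ff' df; have fx : f x = f' x by exact: nbhs_singleton ff'.
have exp : f' \o shift x = cst (f' x) + 'd f x +o_ 0 id.
  apply/eqaddoP => _/posnumP[e].
  have /eqaddoP fe := diff_locally df.
  have sff' : \forall h \near 0, f (h + x) = f' (h + x).
    move: ff'; rewrite (near_shift 0 x); apply: filterS => h.
    by rewrite /= subr0.
  have {}fe := fe _ [gt0 of e%:num].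
  near=> h.
  have -> : (f' \o shift x - (cst (f' x) + 'd f x)) h =
            (f \o shift x - (cst (f x) + 'd f x)) h.
    rewrite -fx !fctE /=; congr (_ - _); apply/esym => /=.
    by near: h.
  by near: h.
have cdf := diff_continuous df.
by apply/diff_locallyP; rewrite (diff_unique cdf exp).
Unshelve. all: by end_near. Qed.

(** The scalar product is a continuous bilinear map, so the product rule is the
   chain rule applied to y |-> (a y, b y). *)
Lemma diff_scale V W (a : V -> R^o) (b : V -> W) x :
  differentiable a x -> differentiable b x ->
  differentiable (fun y => a y *: b y) x /\
  forall v, 'D_v (fun y => a y *: b y) x = 'D_v a x *: b x + a x *: 'D_v b x.
Proof.
move=> da db.
have bil : bilinear_for (GRing.Scale.Law.clone _ _ *:%R _)
    (GRing.Scale.Law.clone _ _ *:%R _) (fun (k : R^o) (w : W) => k *: w).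
  split=> [u'|u] k y z /=; first by rewrite scalerDl scalerA.
  by rewrite scalerDr !scalerA mulrC.
pose B : {bilinear R^o -> W -> W} :=
  HB.pack (fun (k : R^o) (w : W) => k *: w)
    (@bilinear_isBilinear.Build R R^o W W _ _ _ bil).
have cB : continuous (fun p : R^o * W => B p.1 p.2) by exact: scale_continuous.
have dp : differentiable (fun y => (a y, b y)) x by exact: differentiable_pair.
have dB : differentiable (fun p : R^o * W => B p.1 p.2) (a x, b x).
  exact: differentiable_bilin.
have dab : differentiable (fun y => a y *: b y) x.
  exact: (@differentiable_comp _ _ _ _ (fun y => (a y, b y))
    (fun p : R^o * W => B p.1 p.2)).
split=> // v.
rewrite !deriveE //.
rewrite (_ : (fun y => a y *: b y) =
  (fun p : R^o * W => B p.1 p.2) \o (fun y => (a y, b y))) //.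
have E : 'd (fun p : R^o * W => B p.1 p.2) (a x, b x) =
    (fun q => B (a x) q.2 + B q.1 (b x)) :> (R^o * W -> W).
  exact: (diff_bilin (a x, b x) cB).
rewrite (diff_comp dp dB) /= E (diff_pair da db) /=.
by rewrite addrC.
Qed.

Lemma eq_Ck V W k (U : set V) (f f' : V -> W) :
  open U -> (forall x, U x -> f x = f' x) -> Ck k U f -> Ck k U f'.
Proof.
move=> oU; elim: k f f' => [|k IH] f f' ff' /=.
  move=> cf x Ux; have fx := open_near_eq oU ff' Ux.
  change (f' @ x --> f' x); rewrite -(ff' x Ux).
  by apply: cvg_trans (cf x Ux); apply: near_eq_cvg; exact: fx.
move=> [df Df]; split=> [x Ux|v].
  exact: near_eq_differentiable (open_near_eq oU ff' Ux) (df x Ux).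
apply: IH (Df v) => x Ux.
by apply: near_eq_derive; exact: open_near_eq Ux.
Qed.

Lemma sub_Ck V W k (U U' : set V) (f : V -> W) :
  U `<=` U' -> Ck k U' f -> Ck k U f.
Proof.
move=> UU'; elim: k f => [|k IH] f /=; first by move=> cf x /UU'; exact: cf.
by move=> [df Df]; split=> [x /UU'|v]; [exact: df|exact: IH].
Qed.

Lemma CkW V W k (U : set V) (f : V -> W) : Ck k.+1 U f -> Ck k U f.
Proof.
elim: k f => [|k IH] f [df Df].
  by move=> x Ux; exact: differentiable_continuous (df x Ux).
by split=> // v; apply: IH; exact: Df.
Qed.

Lemma Ck_cst V W k (U : set V) (c : W) : Ck k U (fun _ : V => c).
Proof.
elim: k c => [|k IH] c; first by move=> x _; exact: cst_continuous.
split=> [x _|v]; first exact: differentiable_cst.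
rewrite (_ : 'D_v _ = fun=> 0); first exact: IH.
by apply/funext => x; exact: derive_cst.
Qed.

Lemma CkD V W k (U : set V) (f h : V -> W) : open U ->
  Ck k U f -> Ck k U h -> Ck k U (fun x => f x + h x).
Proof.
move=> oU; elim: k f h => [|k IH] f h.
  by move=> cf ch x Ux; apply: cvgD; [exact: cf|exact: ch].
move=> [df Df] [dh Dh]; split=> [x Ux|v].
  by apply: differentiableD; [exact: df|exact: dh].
apply: eq_Ck (IH _ _ (Df v) (Dh v)) => // x Ux; apply/esym.
by apply: deriveD; apply: diff_derivable; [exact: df|exact: dh].
Qed.

Lemma Ck_sum V W k (U : set V) m (f : 'I_m -> V -> W) : open U ->
  (forall i, Ck k U (f i)) -> Ck k U (fun x => \sum_i f i x).
Proof.
move=> oU; elim: m f => [|m IH] f Cf.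
  apply: eq_Ck (Ck_cst k U 0) => // x _.
  by rewrite big_ord0.
have CfS := CkD oU (Cf ord0) (IH (fun i => f (lift ord0 i)) (fun i => Cf _)).
by apply: eq_Ck CfS => // x _; rewrite big_ord_recl.
Qed.

Lemma Ck_scale V W k (U : set V) (a : V -> R^o) (b : V -> W) : open U ->
  Ck k U a -> Ck k U b -> Ck k U (fun x => a x *: b x).
Proof.
move=> oU; elim: k a b => [|k IH] a b.
  by move=> ca cb x Ux; apply: cvgZ; [exact: ca|exact: cb].
move=> Ca Cb; have [[da Da] [db Db]] := (Ca, Cb); split=> [x Ux|v].
  by have [] := diff_scale (da x Ux) (db x Ux).
apply: eq_Ck (CkD oU (IH _ _ (Da v) (CkW Cb)) (IH _ _ (CkW Ca) (Db v))) => //.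
by move=> x Ux; rewrite (diff_scale (da x Ux) (db x Ux)).2.
Qed.

Lemma derive_coord V m (h : V -> 'rV[R]_m) x v j : differentiable h x ->
  differentiable (fun y => h y 0 j : R^o) x /\
  'D_v (fun y => h y 0 j : R^o) x = 'D_v h x 0 j.
Proof.
move=> dh; split.
  apply: (@differentiable_comp _ _ _ _ h (fun N : 'rV[R]_m => N 0 j : R^o)) => //.
  exact: differentiable_coord.
have /derive_mx -> : derivable h x v by exact: diff_derivable.
by rewrite mxE.
Qed.

Lemma Ck_coord V m k (U : set V) (h : V -> 'rV[R]_m) j : open U ->
  Ck k U h -> Ck k U (fun x => h x 0 j : R^o).
Proof.
move=> oU; elim: k h => [|k IH] h.
  move=> ch x Ux; apply: (@continuous_comp _ _ _ h (fun N : 'rV[R]_m => N 0 j)).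
    exact: ch.
  exact: coord_continuous.
move=> [dh Dh]; split=> [x Ux|v]; first by have [] := derive_coord 0 j (dh x Ux).
by apply: eq_Ck (IH _ (Dh v)) => // x Ux; rewrite (derive_coord _ _ (dh x Ux)).2.
Qed.

Lemma derive_comp_rV V W m (h : V -> 'rV[R]_m) (f : 'rV[R]_m -> W) x v :
  differentiable h x -> differentiable f (h x) ->
  'D_v (f \o h) x = 'D_('D_v h x) f (h x).
Proof.
move=> dh df; rewrite !deriveE//; first by rewrite diff_comp.
exact: differentiable_comp.
Qed.

Lemma derive_rV_sum W m (f : 'rV[R]_m -> W) x v : differentiable f x ->
  'D_v f x = \sum_j v 0 j *: 'D_(delta_mx 0 j) f x.
Proof.
move=> df; rewrite deriveE // {1}(row_sum_delta v) linear_sum /=.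
by apply: eq_bigr => j _; rewrite linearZ deriveE.
Qed.

(** The induction needs a chain rule whose right-hand side is again built from
   C^k maps: the derivative of f in the varying direction D_v h is expanded along
   the standard basis, so that only the fixed partial derivatives of f occur. *)
Lemma Ck_comp V W m k (U : set V) (U' : set 'rV[R]_m)
    (h : V -> 'rV[R]_m) (f : 'rV[R]_m -> W) : open U ->
  (forall x, U x -> U' (h x)) ->
  Ck k U h -> Ck k U' f -> Ck k U (f \o h).
Proof.
move=> oU UU'; elim: k h f UU' => [|k IH] h f UU'.
  move=> ch cf x Ux; apply: continuous_comp; first exact: ch.
  by apply: cf; exact: UU'.
move=> Ch Cf; have [[dh Dh] [df Df]] := (Ch, Cf); split=> [x Ux|v].
  by apply: differentiable_comp; [exact: dh|apply: df; exact: UU'].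
have CS : Ck k U (fun x => \sum_j ('D_v h x 0 j : R^o) *:
                            ('D_(delta_mx 0 j) f \o h) x).
  apply: Ck_sum => // j; apply: Ck_scale => //.
    by apply: Ck_coord => //; exact: Dh.
  exact: (IH h _ UU' (CkW Ch) (Df _)).
apply: eq_Ck CS => // x Ux; have dfx := df _ (UU' _ Ux).
by rewrite (derive_comp_rV _ (dh x Ux) dfx) derive_rV_sum.
Qed.

End CkCalculus.

(** * Smooth fields on a manifold *)

Section SmoothFields.
Context {R : realType} {n : nat} {M : manifold R n}.
Implicit Types (c d e : chart R n M) (W : set M) (X Y : vfield M).

(** Smoothness over [W] is tested on these images; that they are open is what
   allows fields to be modified outside [W]. *)
Lemma open_coord_image c W : open W -> open (coord c @` (W `&` dom c)).
Proof.
move=> oW; have oC := @codom_open _ _ _ c.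
have := @unchart_continuous _ _ _ c; rewrite continuous_open_subspace // => ucont.
rewrite openE => y [q [Wq cq] <-]; rewrite /interior.
have Cq : (coord c @` dom c) (coord c q) by exists q.
have cts := ucont _ (mem_set Cq).
have : nbhs (unchart c (coord c q)) W.
  by rewrite chartK //; exact: open_nbhs_nbhs.
move=> /cts; rewrite nbhs_simpl /= => Wnear.
have Cnear : nbhs (coord c q) (coord c @` dom c) by exact: open_nbhs_nbhs.
apply: filterS2 Wnear Cnear => z Wz [q' cq' zq']; exists q' => //; split=> //.
by rewrite -(chartK cq') zq'.
Qed.

Lemma near_coord c q : dom c q -> \forall y \near coord c q, (coord c @` dom c) y.
Proof. by move=> cq; apply: open_nbhs_nbhs; split; [exact: codom_open|exists q]. Qed.

Lemma transition_differentiable c d q : atlas c -> atlas d ->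
  dom c q -> dom d q -> differentiable (coord d \o unchart c) (coord c q).
Proof.
move=> ac ad cq dq; have [df _] := atlas_compat ac ad 1%N.
by apply: df; exists q.
Qed.

(** Independence of the intermediate chart: components in [d] may be computed
   from [c] directly instead of through the chart [e] that represents the tangent
   space at [q]. *)
Lemma derive_transition c e d q v : atlas c -> atlas e -> atlas d ->
  dom c q -> dom e q -> dom d q ->
  'D_('D_v (coord e \o unchart c) (coord c q)) (coord d \o unchart e) (coord e q)
  = 'D_v (coord d \o unchart c) (coord c q).
Proof.
move=> ac ae ad cq eq dq.
have dec := transition_differentiable ac ae cq eq.
have dde : differentiable (coord d \o unchart e)
    ((coord e \o unchart c) (coord c q)).
  by rewrite /= chartK //; exact: transition_differentiable.
rewrite -[in X in 'D_('D_v _ _) _ X](chartK cq) -derive_comp_rV //.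
apply: near_eq_derive.
have : \forall y \near coord c q, (coord c @` (dom e `&` dom c)) y.
  apply: open_nbhs_nbhs; split; first exact: open_coord_image (dom_open e).
  by exists q.
by apply: filterS => _ [q' [eq' cq'] <-] /=; rewrite !chartK.
Qed.

Lemma coord_vfield_at (p : M) v : coord_vfield (chart_at p) v p = v.
Proof.
rewrite /coord_vfield -[RHS](derive_id (coord (chart_at p) p)).
apply: near_eq_derive; have := near_coord (chart_at_dom p).
by apply: filterS => _ [q cq <-] /=; rewrite chartK.
Qed.

(** Read in the chart [d], the components are the derivative along [v] of the
   transition map from [c] to [d], composed with the transition map back. *)
Lemma smooth_coord_vfield c v : atlas c -> smooth_vfield (dom c) (coord_vfield c v).
Proof.
move=> ac d ad k; have oU := open_coord_image (c := d) (dom_open c).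
have Cc : Ck k (coord d @` (dom c `&` dom d)) (coord c \o unchart d).
  by rewrite setIC; exact: atlas_compat.
have [_ /(_ v) CD] := atlas_compat ac ad k.+1.
have UU' y : (coord d @` (dom c `&` dom d)) y ->
    (coord c @` (dom c `&` dom d)) ((coord c \o unchart d) y).
  by move=> [q [cq dq] <-]; exists q => //=; rewrite chartK.
apply: eq_Ck (Ck_comp oU UU' Cc CD) => // _ [q [cq dq] <-] /=; rewrite chartK //.
rewrite /components /vderiv derive_transition //; first exact: chart_at_atlas.
exact: chart_at_dom.
Qed.

Lemma eq_smooth_on (V : normedModType R) W (f f' : M -> V) : open W ->
  (forall q, W q -> f q = f' q) -> smooth_on W f -> smooth_on W f'.
Proof.
move=> oW ff' sf c ac k; apply: eq_Ck (sf c ac k); first exact: open_coord_image.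
by move=> _ [q [Wq cq] <-] /=; rewrite chartK // ff'.
Qed.

Lemma smooth_on_cst (V : normedModType R) W (a : V) : smooth_on (M := M) W (fun=> a).
Proof. by move=> c ac k; exact: Ck_cst. Qed.

Lemma eq_smooth_vfield W X X' : open W ->
  (forall q, W q -> X q = X' q) -> smooth_vfield W X -> smooth_vfield W X'.
Proof.
move=> oW XX' sX c ac k; apply: eq_Ck (sX c ac k); first exact: open_coord_image.
by move=> _ [q [Wq cq] <-] /=; rewrite chartK // /components /vderiv XX'.
Qed.

Lemma sub_smooth_vfield W W' X :
  W `<=` W' -> smooth_vfield W' X -> smooth_vfield W X.
Proof.
move=> WW' sX c ac k; apply: sub_Ck (sX c ac k).
by move=> _ [q [/WW' Wq cq] <-]; exists q.
Qed.

Lemma components_differentiable c q : atlas c -> dom c q ->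
  differentiable (coord c \o unchart (chart_at q)) (coord (chart_at q) q).
Proof.
move=> ac cq; apply: transition_differentiable => //.
  exact: chart_at_atlas.
exact: chart_at_dom.
Qed.

Lemma smooth_vfieldD W X Y : open W ->
  smooth_vfield W X -> smooth_vfield W Y -> smooth_vfield W (fun q => X q + Y q).
Proof.
move=> oW sX sY c ac k; have oU := open_coord_image (c := c) oW.
apply: eq_Ck (CkD oU (sX c ac k) (sY c ac k)) => //.
move=> _ [q [Wq cq] <-] /=; rewrite chartK // /components /vderiv.
by rewrite !deriveE ?linearD //; exact: components_differentiable.
Qed.

Lemma smooth_vfieldZ W (f : M -> R^o) X : open W ->
  smooth_on W f -> smooth_vfield W X -> smooth_vfield W (fun q => f q *: X q).
Proof.
move=> oW sf sX c ac k; have oU := open_coord_image (c := c) oW.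
apply: eq_Ck (Ck_scale oU (sf c ac k) (sX c ac k)) => //.
move=> _ [q [Wq cq] <-] /=; rewrite chartK // /components /vderiv.
by rewrite !deriveE ?linearZ //; exact: components_differentiable.
Qed.

Lemma smooth_vfieldB W X Y : open W ->
  smooth_vfield W X -> smooth_vfield W Y -> smooth_vfield W (fun q => X q - Y q).
Proof.
move=> oW sX sY.
apply: eq_smooth_vfield (smooth_vfieldD oW sX
  (smooth_vfieldZ oW (smooth_on_cst W (-1 : R^o)) sY)) => // q Wq.
by rewrite scaleN1r.
Qed.

Lemma smooth_vfield0 W : smooth_vfield (M := M) W (0 : vfield M).
Proof.
move=> c ac k; rewrite (_ : _ \o _ = fun=> 0); first exact: Ck_cst.
by apply/funext => y /=; rewrite /components /vderiv derive0.
Qed.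

Lemma vderiv_cst (V : normedModType R) X (a : V) p : vderiv X (fun=> a) p = 0.
Proof. exact: derive_cst. Qed.

End SmoothFields.

(** * Local calculus of a linear connection *)

Section Connection.
Context {R : realType} {n : nat} {M : manifold R n}.
Context (D : vfield M -> vfield M -> vfield M) (Dconn : is_connection D).
Implicit Types (W : set M) (X Y : vfield M).

(** The Leibniz rule for the indicator [chi] of [W], which is smooth on [W]
   since it is constant there: chi Y and chi Y' are the same global field, and at
   a point of [W] both derivatives differ from the ones sought by the same
   term X(chi) Y. *)
Lemma connection_local W X Y Y' p : open W -> smooth_vfield W X ->
  smooth_vfield W Y -> (forall q, W q -> Y q = Y' q) -> W p ->
  D X Y p = D X Y' p.
Proof.
move=> oW sX sY YY' Wp.
have sY' : smooth_vfield W Y' by exact: eq_smooth_vfield sY.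
pose chi q : R^o := (`[< W q >])%:R.
have chi1 q : W q -> chi q = 1 by move=> Wq; rewrite /chi asboolT.
have schi : smooth_on W chi.
  by apply: eq_smooth_on (smooth_on_cst W (1 : R^o)) => // q Wq; rewrite chi1.
have chiYY' : (fun q => chi q *: Y q) = (fun q => chi q *: Y' q).
  apply/funext => q; rewrite /chi; case: asboolP => [/YY'->//|_].
  by rewrite !scale0r.
have := connection_leibniz Dconn oW schi sX sY Wp.
rewrite chiYY' (connection_leibniz Dconn oW schi sX sY' Wp) YY' //.
by rewrite chi1 // !scale1r => /addIr.
Qed.

Lemma connectionZ W X Y (a : R) p : open W -> smooth_vfield W X ->
  smooth_vfield W Y -> W p -> D X (fun q => a *: Y q) p = a *: D X Y p.
Proof.
move=> oW sX sY Wp.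
have sa := smooth_on_cst W (a : R^o).
by rewrite (connection_leibniz Dconn oW sa sX sY Wp) vderiv_cst scale0r addr0.
Qed.

Lemma connection0 W X p : open W -> smooth_vfield W X -> W p -> D X 0 p = 0.
Proof.
move=> oW sX Wp; have := connectionZ 0 oW sX (smooth_vfield0 W) Wp.
rewrite scale0r => <-; congr (D X _ p).
by apply/funext => q; rewrite scale0r.
Qed.

End Connection.

(** * The scalar product of tangent vectors *)

Section InnerProduct.
Context {R : realType} {n : nat} {M : manifold R n} (g : M -> 'M[R]_n).
Implicit Types (p : M) (u v w : 'rV[R]_n).

Definition ip p u v : R := (u *m g p *m v^T) 0 0.

Lemma innerE (X Y : vfield M) p : inner g X Y p = ip p (X p) (Y p).
Proof. by []. Qed.

Lemma ipDl p u v w : ip p (u + v) w = ip p u w + ip p v w.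
Proof. by rewrite /ip !mulmxDl mxE. Qed.

Lemma ipZl p a u w : ip p (a *: u) w = a * ip p u w.
Proof. by rewrite /ip -!scalemxAl mxE. Qed.

Lemma ipNl p u w : ip p (- u) w = - ip p u w.
Proof. by rewrite -scaleN1r ipZl mulN1r. Qed.

Lemma ip0l p w : ip p 0 w = 0.
Proof. by rewrite /ip !mul0mx mxE. Qed.

Lemma ip0r p w : ip p w 0 = 0.
Proof. by rewrite /ip trmx0 mulmx0 mxE. Qed.

Lemma ipC p u v : (g p)^T = g p -> ip p u v = ip p v u.
Proof.
move=> gT.
(* A 1 x 1 matrix equals its transpose. *)
rewrite /ip -[RHS](mxE trmx_key (fun i j => (v *m g p *m u^T) j i)).
by rewrite -/(trmx _) !trmx_mul trmxK gT mulmxA.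
Qed.

(** The projection onto the complement of a unit timelike vector has corank one;
   the formula for [lin1_mx] only involves the images of basis vectors. *)
Lemma trace_spatial p (P : 'rV[R]_n) a : ip p P P = -1 ->
  \tr (lin1_mx (fun v => a *: (v + ip p v P *: P))) = a * (n%:R - 1).
Proof.
move=> PP; rewrite /mxtrace.
under eq_bigr => i _ do rewrite !mxE !eqxx /=.
rewrite -mulr_sumr big_split /= sumr_const card_ord; congr (_ * (_ + _)).
rewrite -PP [RHS]/ip [X in X *m _ *m _](row_sum_delta P) !mulmx_suml summxE.
by apply: eq_bigr => i _; rewrite -!scalemxAl mxE mulrC.
Qed.

End InnerProduct.

(** * Curvatures along the generator of a P-connection *)

Section PConnection.
Context {R : realType} {n : nat} {M : manifold R n.+1}.
Context (g : M -> 'M[R]_n.+1) (P : vfield M).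
Context (D : vfield M -> vfield M -> vfield M).
Context (g_lorentzian : is_lorentzian g) (D_LC : is_levi_civita g D).
Context (P_smooth : smooth_vfield setT P).
Context (P_unit : forall p, inner g P P p = -1).
Context (P_connection : is_parallel (nabla1 g P D) P).
Implicit Types (W : set M) (X Y : vfield M).

Let conn := levi_civita_connection D_LC.
Let gT := Defs.metric_sym g_lorentzian.
Let D1 := nabla1 g P D.
Let D2 := mutual D1.
Let D0 := symmetrized D1.

Lemma ipPP p : ip g p (P p) (P p) = -1.
Proof. exact: P_unit. Qed.

Lemma P_smooth_on W : smooth_vfield W P.
Proof. exact: sub_smooth_vfield P_smooth. Qed.
Hint Resolve P_smooth_on : core.

(** The orthogonal projection onto the complement of [P]. *)
Definition spatial X : vfield M := fun q => X q + ip g q (X q) (P q) *: P q.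

Lemma connection_P W X p : open W -> smooth_vfield W X -> W p ->
  D X P p = spatial X p.
Proof.
move=> oW sX Wp; have := P_connection oW sX Wp.
rewrite /nabla1 P_unit scaleN1r => /eqP; rewrite subr_eq0 => /eqP DXP.
by rewrite /spatial -innerE -DXP addrC subrK.
Qed.

Lemma spatial_P p : spatial P p = 0.
Proof. by rewrite /spatial ipPP scaleN1r subrr. Qed.

Lemma connection_PP p : D P P p = 0.
Proof.
rewrite (@connection_P setT) ?spatial_P //; exact: openT.
Qed.

Lemma spatial_smooth W X : open W -> smooth_vfield W X ->
  smooth_vfield W (spatial X).
Proof.
move=> oW sX; apply: eq_smooth_vfield (connection_smooth conn oW sX (P_smooth_on W)) => //.
by move=> q; exact: connection_P.
Qed.

(** Since nabla_P P = 0, P(pi(X)) = pi(nabla_P X), hence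
   nabla_P (pi(X) P) = pi(nabla_P X) P. *)
Lemma connection_P_spatial W X p : open W -> smooth_vfield W X -> W p ->
  D P (spatial X) p = spatial (D P X) p.
Proof.
move=> oW sX Wp; have sP := P_smooth_on W.
have sXP := metric_smooth g_lorentzian oW sX sP.
have sZ := smooth_vfieldZ oW sXP sP.
rewrite (connection_addr conn oW sP sX sZ Wp).
rewrite (connection_leibniz conn oW sXP sP sP Wp) connection_PP scaler0 add0r.
rewrite (levi_civita_metric D_LC oW sP sX sP Wp) !innerE connection_PP ip0r addr0.
by [].
Qed.

Lemma nabla1_P Y p : D1 P Y p = D P Y p.
Proof.
rewrite /D1 /nabla1 !innerE (ipC _ _ (gT p)).
by rewrite addrK.
Qed.

Lemma nabla1_PE W X p : open W -> smooth_vfield W X -> W p -> D1 X P p = 0.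
Proof. by move=> oW sX; exact: (P_connection oW sX). Qed.

Lemma bracketE W X Y p : open W -> smooth_vfield W X -> smooth_vfield W Y ->
  W p -> bracket X Y p = D X Y p - D Y X p.
Proof. by move=> oW sX sY Wp; rewrite (levi_civita_torsion_free D_LC oW). Qed.

Lemma bracket_smooth W X Y : open W -> smooth_vfield W X -> smooth_vfield W Y ->
  smooth_vfield W (bracket X Y).
Proof.
move=> oW sX sY.
apply: eq_smooth_vfield (smooth_vfieldB oW (connection_smooth conn oW sX sY)
  (connection_smooth conn oW sY sX)) => // q Wq.
by rewrite (@bracketE W).
Qed.

Lemma mutualE W X Y p : open W -> smooth_vfield W X -> smooth_vfield W Y ->
  W p ->
  D2 X Y p = D X Y p + ip g p (X p) (P p) *: Y p - ip g p (X p) (Y p) *: P p.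
Proof.
move=> oW sX sY Wp; rewrite /D2 /mutual /= (_ : (_ + _) p = D1 Y X p + bracket X Y p) //.
rewrite (bracketE oW sX sY Wp) /D1 /nabla1 !innerE.
rewrite (ipC (Y p) _ (gT p)).
by apply/rowP => i; rewrite !mxE; ring.
Qed.

Lemma mutual_P W X p : open W -> smooth_vfield W X -> W p ->
  D2 X P p = spatial X p.
Proof.
by move=> oW sX Wp; rewrite (mutualE oW) // addrK; exact: connection_P Wp.
Qed.

Lemma symmetrizedE W X Y p : open W -> smooth_vfield W X -> smooth_vfield W Y ->
  W p ->
  D0 X Y p = D X Y p
    + 2^-1 *: (ip g p (X p) (P p) *: Y p + ip g p (Y p) (P p) *: X p)
    - ip g p (X p) (Y p) *: P p.
Proof.
move=> oW sX sY Wp.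
rewrite (_ : D0 X Y p = 2^-1 *: (D1 X Y p + D2 X Y p)) // (mutualE oW) //.
rewrite /D1 /nabla1 !innerE.
by apply/rowP => i; rewrite !mxE; field.
Qed.

Lemma symmetrized_P W X p : open W -> smooth_vfield W X -> W p ->
  D0 X P p = 2^-1 *: spatial X p.
Proof.
move=> oW sX Wp; rewrite (_ : D0 X P p = 2^-1 *: (D1 X P p + D2 X P p)) //.
by rewrite (nabla1_PE oW) // (mutual_P oW) // add0r.
Qed.

Lemma mutual_Pl W X p : open W -> smooth_vfield W X -> W p ->
  D2 P X p = D P X p - spatial X p.
Proof.
move=> oW sX Wp; rewrite (mutualE oW) //.
rewrite ipPP scaleN1r /spatial (ipC _ _ (gT p)).
by rewrite opprD addrA.
Qed.

Lemma spatialB u v p : spatial (fun q => u q - v q) p = spatial u p - spatial v p.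
Proof.
by rewrite /spatial ipDl ipNl; apply/rowP => i; rewrite !mxE; ring.
Qed.

Lemma ip_spatial_P X p : ip g p (spatial X p) (P p) = 0.
Proof. by rewrite /spatial ipDl ipZl ipPP mulrN1 subrr. Qed.

Lemma spatial_idem X p : spatial (spatial X) p = spatial X p.
Proof.
by rewrite {1}/spatial ip_spatial_P scale0r addr0.
Qed.

Lemma eq_spatial X Y p : X p = Y p -> spatial X p = spatial Y p.
Proof. by rewrite /spatial => ->. Qed.

(** Both D1 P P and D1 X P vanish, so two terms survive: minus
   nabla_P A(X) = A(nabla_P X), and D2 (D2 P X) P = A(nabla_P X - A(X)). *)
Lemma curv4_PP W X p : open W -> smooth_vfield W X -> W p ->
  curv4 D1 X P P p = (-1) *: spatial X p.
Proof.
move=> oW sX Wp; have sP := P_smooth_on W.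
have sA := spatial_smooth oW sX.
rewrite (_ : curv4 D1 X P P p =
  D2 X (D1 P P) p - D1 P (D2 X P) p + D2 (D2 P X) P p - D1 (D1 X P) P p) //.
have D1PP : D1 P P = 0 by apply/funext => q; exact: (@nabla1_PE setT) openT _ _.
have D2XP q : W q -> spatial X q = D2 X P q by move=> Wq; rewrite (mutual_P oW).
have D2PX q : W q -> D P X q - spatial X q = D2 P X q.
  by move=> Wq; rewrite (mutual_Pl oW).
have sD1 : smooth_vfield W (D1 X P).
  apply: eq_smooth_vfield (smooth_vfield0 W) => // q Wq.
  by rewrite (nabla1_PE oW).
have sDPX := connection_smooth conn oW sP sX.
have sD2 := eq_smooth_vfield oW D2PX (smooth_vfieldB oW sDPX sA).
rewrite D1PP (mutualE oW sX (smooth_vfield0 W) Wp) (connection0 conn oW) //.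
rewrite scaler0 ip0r scale0r nabla1_P -(connection_local conn oW sP sA D2XP Wp).
rewrite (connection_P_spatial oW) // (mutual_P oW) // (nabla1_PE oW) //.
rewrite -(@eq_spatial (fun q => D P X q - spatial X q) (D2 P X) p (D2PX p Wp)).
rewrite spatialB spatial_idem.
by rewrite scaleN1r !subr0 !add0r addrA addNr add0r.
Qed.

Lemma spatial_bracket W X p : open W -> smooth_vfield W X -> W p ->
  spatial (bracket X P) p = spatial X p - spatial (D P X) p.
Proof.
move=> oW sX Wp; rewrite (eq_spatial (Y := fun q => spatial X q - D P X q)).
  by rewrite spatialB spatial_idem.
by rewrite (bracketE oW sX (P_smooth_on W) Wp) (connection_P oW).
Qed.

(** Since D0 X P = A(X)/2, one subtracts
   D0 P (A(X)/2) = A(nabla_P X)/2 - A(X)/4, the last part coming from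
   pi(P) = -1, and A([X, P])/2 = A(X)/2 - A(nabla_P X)/2. *)
Lemma curv0_PP W X p : open W -> smooth_vfield W X -> W p ->
  curv0 D1 X P P p = (- 4^-1) *: spatial X p.
Proof.
move=> oW sX Wp; have sP := P_smooth_on W.
have sA := spatial_smooth oW sX.
have sB := bracket_smooth oW sX sP.
rewrite (_ : curv0 D1 X P P p =
  D0 X (D0 P P) p - D0 P (D0 X P) p - D0 (bracket X P) P p) //.
have D0PP : D0 P P = 0.
  apply/funext => q; rewrite (@symmetrized_P setT) ?spatial_P ?scaler0 //.
  exact: openT.
have D0XP q : W q -> 2^-1 *: spatial X q = D0 X P q.
  by move=> Wq; rewrite (symmetrized_P oW).
have sA2 := smooth_vfieldZ oW (smooth_on_cst W (2^-1 : R^o)) sA.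
have sD0 := eq_smooth_vfield oW D0XP sA2.
rewrite D0PP (symmetrizedE oW sX (smooth_vfield0 W) Wp) (connection0 conn oW) //.
rewrite ip0l ip0r !scale0r scaler0 addr0 scaler0 subr0 add0r.
rewrite (symmetrizedE oW sP sD0 Wp) -(connection_local conn oW sP sA2 D0XP Wp).
rewrite (connectionZ conn _ oW sP sA Wp) (connection_P_spatial oW) //.
rewrite -(D0XP p Wp) (symmetrized_P oW sB Wp) (spatial_bracket oW) //.
rewrite (ipC (P p) _ (gT p)) !ipZl ipPP ip_spatial_P.
by apply/rowP => i; rewrite !mxE; field.
Qed.

(** Up to the factor 1/2, one subtracts nabla_P A(X) = A(nabla_P X) and
   D2 [X, P] P = A(X) - A(nabla_P X). *)
Lemma curv5_PP W X p : open W -> smooth_vfield W X -> W p ->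
  curv5 D1 X P P p = (- 2^-1) *: spatial X p.
Proof.
move=> oW sX Wp; have sP := P_smooth_on W.
have sA := spatial_smooth oW sX.
have sB := bracket_smooth oW sX sP.
rewrite (_ : curv5 D1 X P P p =
  2^-1 *: (D1 X (D1 P P) p - D2 P (D1 X P) p + D2 X (D2 P P) p - D1 P (D2 X P) p
           - D1 (bracket X P) P p - D2 (bracket X P) P p)) //.
have D1PP : D1 P P = 0 by apply/funext => q; exact: (@nabla1_PE setT) openT _ _.
have D2PP : D2 P P = 0.
  apply/funext => q; rewrite (@mutual_P setT) ?spatial_P //; exact: openT.
have D1XP q : W q -> 0 = D1 X P q by move=> Wq; rewrite (nabla1_PE oW).
have D2XP q : W q -> spatial X q = D2 X P q by move=> Wq; rewrite (mutual_P oW).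
have s0 := smooth_vfield0 (M := M) W.
have sD1 := eq_smooth_vfield oW D1XP s0.
rewrite D1PP D2PP !(mutualE oW) // -(connection_local conn oW sP s0 D1XP Wp).
rewrite -(D1XP p Wp).
rewrite nabla1_P -(connection_local conn oW sP sA D2XP Wp).
rewrite (connection_P_spatial oW) // (nabla1_PE oW sB Wp) addrK.
rewrite (connection_P oW sB Wp) (spatial_bracket oW sX Wp).
rewrite (_ : D1 X 0 p = 0); last first.
  rewrite /D1 /nabla1 !innerE ip0l ip0r !scale0r subr0 addr0.
  exact: connection0 Wp.
rewrite !(connection0 conn oW) // !ip0r !scaler0 !scale0r.
by apply/rowP => i; rewrite !mxE; field.
Qed.

Lemma ricci_PP (Rm : vfield M -> vfield M -> vfield M -> vfield M) a p :
  (forall W X p, open W -> smooth_vfield W X -> W p ->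
    Rm X P P p = a *: spatial X p) ->
  ricci Rm P P p = a * n%:R.
Proof.
move=> RmE; rewrite /ricci.
have -> : (fun v => Rm (coord_vfield (chart_at p) v) P P p) =
    (fun v => a *: (v + ip g p v (P p) *: P p)).
  apply/funext => v.
  rewrite (RmE (dom (chart_at p))) ?/spatial ?coord_vfield_at //.
  - exact: dom_open.
  - by apply: smooth_coord_vfield; exact: chart_at_atlas.
  - exact: chart_at_dom.
by rewrite trace_spatial ?ipPP // -natr1 addrK.
Qed.

(** As [P] is smooth on the whole manifold, the tensor may be tested on the pair
   ([P], [P]), at any point. *)
Lemma ricci_nonzero (Rm : vfield M -> vfield M -> vfield M -> vfield M) a :
  (0 < n)%N -> a != 0 ->
  (forall W X p, open W -> smooth_vfield W X -> W p ->
    Rm X P P p = a *: spatial X p) ->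
  ~ is_zero_tensor (ricci Rm).
Proof.
move=> n_gt0 a0 RmE Ric0; have [p _] := @carrier_nonempty _ _ M.
have /eqP := Ric0 P P P_smooth P_smooth p.
by rewrite (ricci_PP p RmE) mulf_eq0 (negbTE a0) pnatr_eq0 eqn0Ngt n_gt0.
Qed.

End PConnection.

Theorem theorem4p5 (R : realType) (n : nat) (n_ge3 : (3 <= n.+1)%N)
    (M : manifold R n.+1) (g : M -> 'M[R]_n.+1) (P : vfield M)
    (nablag : vfield M -> vfield M -> vfield M)
    (g_lorentzian : is_lorentzian g)
    (g_GRW : is_GRW g)
    (nablag_LC : is_levi_civita g nablag)
    (P_smooth : smooth_vfield setT P)
    (P_unit : forall p, inner g P P p = -1)
    (P_connection : is_parallel (nabla1 g P nablag) P) :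
  ~ is_zero_tensor (ricci (curv0 (nabla1 g P nablag))) /\
  ~ is_zero_tensor (ricci (curv4 (nabla1 g P nablag))) /\
  ~ is_zero_tensor (ricci (curv5 (nabla1 g P nablag))).
Proof.
have n_gt0 : (0 < n)%N := ltnW n_ge3.
have Ric_neq0 := @ricci_nonzero _ _ _ g P P_smooth P_unit.
split; last split.
- apply: (Ric_neq0 _ (- 4^-1) n_gt0); first by rewrite oppr_eq0 invr_eq0 pnatr_eq0.
  by move=> W X p; exact: curv0_PP.
- apply: (Ric_neq0 _ (-1) n_gt0); first by rewrite oppr_eq0 oner_eq0.
  by move=> W X p; exact: curv4_PP.
- apply: (Ric_neq0 _ (- 2^-1) n_gt0); first by rewrite oppr_eq0 invr_eq0 pnatr_eq0.
  by move=> W X p; exact: curv5_PP.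
Qed.
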